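(* Let $\Delta t>0$ and $\Delta\tau>0$ be the physical and pseudotime step sizes. Assume that the densities $\rho^k$ at pseudotime level $k$ and $\rho^n$ at physical time level $n$ are strictly positive at all solution points (including the neighbouring states entering the fluxes). Let the discrete density at pseudotime level $k+1$ be defined at each solution point $(i_1,i_2,i_3)$ by the first-order dual time-stepping BDF1 update $$J_{i_1i_2i_3}\,\rho^{k+1}_{i_1i_2i_3}=\frac{\Delta t}{\Delta t+\Delta\tau}\left(J_{i_1i_2i_3}\rho^{k}_{i_1i_2i_3}+\frac{\Delta\tau}{\Delta t}J_{i_1i_2i_3}\rho^{n}_{i_1i_2i_3}-\Delta\tau\sum_{d=1}^{3}\frac{\hat{\bar f}^{\rho+}_{i_d}-\hat{\bar f}^{\rho-}_{i_d}}{\Delta\bar\xi_{i_d}}\right),$$ where the mass fluxes, evaluated at pseudotime level $k$, are $$\hat{\bar f}^{\rho\pm}_{i_d}=\hat{\bar m}^{\pm}_{i_d}-\mathscr D^{\pm}_{i_d}\,\Delta^{\pm}_{i_d}\rho ,$$ and the dissipation coefficients satisfy $$\mathscr D^{\pm}_{i_d}\ \ge\ \mathscr D^{\pm}_{i_d,\min}=\frac{|\hat{\bar m}^{\pm}_{i_d}|}{2\rho^{\pm}_{i_d,A}}$$ for all solution points and all $d=1,2,3$. If $$\Delta\tau<\Delta\tau^{\rho}_1:=\min_{i_1,i_2,i_3}\ \frac{1}{\dfrac{2}{J_{i_1i_2i_3}}\displaystyle\sum_{d=1}^{3}\frac{\mathscr D^{+}_{i_d}+\mathscr D^{-}_{i_d}}{\Delta\bar\xi_{i_d}}-\dfrac{1}{\Delta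 t}\dfrac{\rho^{n}_{i_1i_2i_3}}{\rho^{k}_{i_1i_2i_3}}},$$ where a solution point at which the denominator is less than or equal to zero imposes no constraint (its contribution to the minimum is $+\infty$), then $\rho^{k+1}_{i_1i_2i_3}>0$ at every solution point.
   Context: The setting is a finite-volume-type discretization of the continuity equation in three curvilinear coordinates $(\xi_1,\xi_2,\xi_3)$ on finitely many hexahedral elements, each with a tensor-product grid of Legendre-Gauss-Lobatto solution points indexed by $(i_1,i_2,i_3)$. $J_{i_1i_2i_3}>0$ is the Jacobian of the mapping from the reference element at the solution point. $\Delta\bar\xi_{i_d}>0$ is the width of the control volume around the point in direction $d$, i.e. the distance between the two flux points surrounding it, equal to the corresponding diagonal entry of the one-dimensional mass (quadrature) matrix. For a solution point and a direction $d$, $\rho_{i_d}$ denotes the density at that point and $\rho_{i_d\pm1}$ the density of the neighbouring state in the positive/negative $\xi_d$ direction; all are evaluated at pseudotime level $k$ and - $\Delta^{+}_{i_d}\rho=\rho_{i_d+1}-\rho_{i_d}$, $\ \Delta^{-}_{i_d}\rho=\rho_{i_d}-\rho_{i_d-1}$; - $\rho^{\pm}_{i_d,A}=(\rho_{i_d}+\rho_{i_d\pm1})/2$. The real number $\hat{\bar m}^{+}_{i_d}$ (resp. $\hat{\bar m}^{-}_{i_d}$) is the mass component (momentum) of the two-point entropy-conservative inviscid flux contracted with the metric vector approximating $J\,\partial\xi_d/\partial\mathbf x$ at the flux point on the positive (resp. negative) side, based on the states at $i_d,i_d+1$ (resp. $i_d-1,i_d$). A two-point entropy-conservative flux is a symmetric,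 consistent two-point numerical flux $f_S(u_L,u_R)$ for the compressible Euler flux satisfying Tadmor's condition $(w_R-w_L)^\top f_S(u_L,u_R)=\psi_R-\psi_L$ with $w$ the entropy variables and $\psi$ the entropy potential flux. $\mathscr D^{\pm}_{i_d}$ are real dissipation coefficients. *)

(* Defs.v *)
(* MathComp-Analysis *)
From HB Require Import structures.
From mathcomp Require Import all_boot all_order all_algebra.
From mathcomp Require Import all_classical all_reals all_analysis.

Set Implicit Arguments.
Unset Strict Implicit.
Unset Printing Implicit Defensive.

Import Order.TTheory GRing.Theory Num.Theory.
Import numFieldNormedType.Exports.

Local Open Scope classical_set_scope.
Local Open Scope ring_scope.

(** * One-dimensional Legendre-Gauss-Lobatto grid on [-1, 1] *)

(* Rodrigues' formula. *)
Definition legendre (R : realType) (p : nat) : {poly R} :=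
  (2 ^+ p * (p`!)%:R)^-1 *: (('X^2 - 1) ^+ p)^`(p).

(* For p > 0 the polynomial (1 - X^2) P_p' has degree p + 1, so its p + 1
   increasing roots are all of its roots. *)
Definition lgl_nodes (R : realType) (p : nat) (xi : 'I_p.+1 -> R) : Prop :=
  (forall i j : 'I_p.+1, (i < j)%N -> xi i < xi j) /\
  (forall i : 'I_p.+1, root ((1 - 'X^2) * (legendre R p)^`()) (xi i)).

Definition lagrange_basis (R : realType) (p : nat) (xi : 'I_p.+1 -> R)
    (i : 'I_p.+1) : {poly R} :=
  \prod_(j < p.+1 | j != i) ((xi i - xi j)^-1 *: ('X - (xi j)%:P)).

(* Diagonal entry of the collocated mass matrix, that is, the quadrature
   weight of node i. *)
Definition mass_entry (R : realType) (p : nat) (xi : 'I_p.+1 -> R)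
    (i : 'I_p.+1) : R :=
  \int[lebesgue_measure]_(x in `[(-1 : R), 1]) (lagrange_basis xi i).[x].

(* There are p + 2 flux points; solution point i lies between flux points
   i and i + 1. *)
Definition fp_below (p : nat) (i : 'I_p.+1) : 'I_p.+2 := widen_ord (leqnSn _) i.
Definition fp_above (p : nat) (i : 'I_p.+1) : 'I_p.+2 := lift ord0 i.

Definition cv_width (R : realType) (p : nat) (xibar : 'I_p.+2 -> R)
    (i : 'I_p.+1) : R :=
  xibar (fp_above i) - xibar (fp_below i).

Definition lgl_flux_points (R : realType) (p : nat) (xi : 'I_p.+1 -> R)
    (xibar : 'I_p.+2 -> R) : Prop :=
  xibar ord0 = -1 /\ (forall i : 'I_p.+1, cv_width xibar i = mass_entry xi i).

(** * Tensor-product grid on the hexahedral elements *)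

(* Multi-index (i_1, i_2, i_3) in one element. *)
Definition multi_index (p : nat) : finType := {ffun 'I_3 -> 'I_p.+1}.

(* Solution point = (element, multi-index).  Collocated points of two adjacent
   elements are distinct solution points. *)
Definition solpt (E : finType) (p : nat) : finType := (E * multi_index p)%type.

Inductive side := Minus | Plus.

Definition ref_point (R : realType) (p : nat) (xi : 'I_p.+1 -> R)
    (i : multi_index p) : 'rV[R]_3 :=
  \row_d xi (i d).

(* Jacobian determinant of the mapping X e of element e at a solution point. *)
Definition jac (R : realType) (E : finType) (p : nat) (xi : 'I_p.+1 -> R)
    (X : E -> 'rV[R]_3 -> 'rV[R]_3) (x : solpt E p) : R :=
  \det ('J (X x.1) (ref_point xi x.2)).

(* The flux point in direction d on side s of the solution point i: component d
   numbers a flux point, the other components number solution points.  Thus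
   (Plus, i_d) and (Minus, i_d + 1) give the same flux point. *)
Definition flux_index (p : nat) (d : 'I_3) (s : side) (i : multi_index p) :
    {ffun 'I_3 -> 'I_p.+2} :=
  [ffun c => if c == d then
               match s with
               | Plus => fp_above (i c)
               | Minus => fp_below (i c)
               end
             else fp_below (i c)].

Definition shift_index (p : nat) (d : 'I_3) (s : side) (i : multi_index p) :
    multi_index p :=
  [ffun c => if c == d then
               match s with
               | Plus => inord (i c).+1
               | Minus => inord (i c).-1
               end
             else i c].

(* No solution point of the same element lies beyond i on side s. *)
Definition on_face (p : nat) (d : 'I_3) (s : side) (i : multi_index p) : bool :=
  match s with
  | Plus => (i d == p :> nat)
  | Minus => (i d == 0%N :> nat)
  end.

(* Neighbouring state at i_d + 1 or i_d - 1.  On an element face it is the state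
   uext on the other side of the face, coming from the adjacent element or from
   the boundary condition. *)
Definition nbr_state (R : realType) (E : finType) (p : nat)
    (u : solpt E p -> 'rV[R]_5) (uext : solpt E p -> 'I_3 -> side -> 'rV[R]_5)
    (x : solpt E p) (d : 'I_3) (s : side) : 'rV[R]_5 :=
  if on_face d s x.2 then uext x d s else u (x.1, shift_index d s x.2).

(** * Compressible Euler equations *)

(* A state is the vector of conservative variables
   (rho, rho v_1, rho v_2, rho v_3, rho E). *)
Definition density (R : realType) (u : 'rV[R]_5) : R := u 0 ord0.
Definition momentum (R : realType) (u : 'rV[R]_5) (l : 'I_3) : R :=
  u 0 (inord l.+1).
Definition total_energy (R : realType) (u : 'rV[R]_5) : R := u 0 ord_max.

Definition velocity (R : realType) (u : 'rV[R]_5) (l : 'I_3) : R :=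
  momentum u l / density u.

Definition pressure (R : realType) (gam : R) (u : 'rV[R]_5) : R :=
  (gam - 1) *
    (total_energy u - 2^-1 * density u * \sum_(l < 3) velocity u l ^+ 2).

Definition temperature (R : realType) (gam Rgas : R) (u : 'rV[R]_5) : R :=
  pressure gam u / (density u * Rgas).

Definition admissible (R : realType) (gam Rgas : R) (u : 'rV[R]_5) : Prop :=
  0 < density u /\ 0 < temperature gam Rgas u.

Definition euler_flux (R : realType) (gam : R) (l : 'I_3) (u : 'rV[R]_5) :
    'rV[R]_5 :=
  \row_(j < 5)
    if j == ord0 then momentum u l
    else if j == ord_max then (total_energy u + pressure gam u) * velocity u l
    else momentum u (inord j.-1) * velocity u l
         + (if j == l.+1 :> nat then pressure gam u else 0).

(* Specific entropy of the perfect gas: s = c_v ln T - R ln rho,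
   with c_v = R / (gam - 1). *)
Definition spec_entropy (R : realType) (gam Rgas : R) (u : 'rV[R]_5) : R :=
  Rgas / (gam - 1) * ln (temperature gam Rgas u) - Rgas * ln (density u).

(* Entropy pair (S, F_l) = (- rho s, - rho s v_l). *)
Definition math_entropy (R : realType) (gam Rgas : R) (u : 'rV[R]_5) : R :=
  - density u * spec_entropy gam Rgas u.

Definition entropy_flux (R : realType) (gam Rgas : R) (l : 'I_3)
    (u : 'rV[R]_5) : R :=
  math_entropy gam Rgas u * velocity u l.

(* w = dS/du *)
Definition entropy_var (R : realType) (gam Rgas : R) (u : 'rV[R]_5) :
    'rV[R]_5 :=
  \row_(j < 5) 'D_(delta_mx 0 j) (math_entropy gam Rgas) u.

Definition dotv (R : realType) (n : nat) (a b : 'rV[R]_n) : R :=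
  \sum_(j < n) a 0 j * b 0 j.

(* psi_l = w . f_l - F_l *)
Definition entropy_potential_flux (R : realType) (gam Rgas : R) (l : 'I_3)
    (u : 'rV[R]_5) : R :=
  dotv (entropy_var gam Rgas u) (euler_flux gam l u) - entropy_flux gam Rgas l u.

(* fS l is the two-point flux in the l-th Cartesian direction; its values are
   constrained on admissible states only, where the entropy is defined. *)
Definition entropy_conservative (R : realType) (gam Rgas : R)
    (fS : 'I_3 -> 'rV[R]_5 -> 'rV[R]_5 -> 'rV[R]_5) : Prop :=
  [/\ forall l uL uR, admissible gam Rgas uL -> admissible gam Rgas uR ->
        fS l uL uR = fS l uR uL,
      forall l u, admissible gam Rgas u -> fS l u u = euler_flux gam l u
    & forall l uL uR, admissible gam Rgas uL -> admissible gam Rgas uR ->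
        dotv (entropy_var gam Rgas uR - entropy_var gam Rgas uL) (fS l uL uR)
        = entropy_potential_flux gam Rgas l uR
          - entropy_potential_flux gam Rgas l uL].

(** * First-order scheme for the density *)

(* Mass component of the two-point flux between the point and its neighbour on
   side s, contracted with the metric vector a e d g at the flux point g that
   separates them. *)
Definition mass_flux_ec (R : realType) (E : finType) (p : nat)
    (fS : 'I_3 -> 'rV[R]_5 -> 'rV[R]_5 -> 'rV[R]_5)
    (a : E -> 'I_3 -> {ffun 'I_3 -> 'I_p.+2} -> 'rV[R]_3)
    (u : solpt E p -> 'rV[R]_5) (uext : solpt E p -> 'I_3 -> side -> 'rV[R]_5)
    (x : solpt E p) (d : 'I_3) (s : side) : R :=
  \sum_(l < 3)
    a x.1 d (flux_index d s x.2) 0 l *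
    density match s with
            | Plus => fS l (u x) (nbr_state u uext x d Plus)
            | Minus => fS l (nbr_state u uext x d Minus) (u x)
            end.

Definition delta_density (R : realType) (E : finType) (p : nat)
    (u : solpt E p -> 'rV[R]_5) (uext : solpt E p -> 'I_3 -> side -> 'rV[R]_5)
    (x : solpt E p) (d : 'I_3) (s : side) : R :=
  match s with
  | Plus => density (nbr_state u uext x d Plus) - density (u x)
  | Minus => density (u x) - density (nbr_state u uext x d Minus)
  end.

Definition mean_density (R : realType) (E : finType) (p : nat)
    (u : solpt E p -> 'rV[R]_5) (uext : solpt E p -> 'I_3 -> side -> 'rV[R]_5)
    (x : solpt E p) (d : 'I_3) (s : side) : R :=
  (density (u x) + density (nbr_state u uext x d s)) / 2.

Definition mass_flux (R : realType) (E : finType) (p : nat)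
    (fS : 'I_3 -> 'rV[R]_5 -> 'rV[R]_5 -> 'rV[R]_5)
    (a : E -> 'I_3 -> {ffun 'I_3 -> 'I_p.+2} -> 'rV[R]_3)
    (D : solpt E p -> 'I_3 -> side -> R)
    (u : solpt E p -> 'rV[R]_5) (uext : solpt E p -> 'I_3 -> side -> 'rV[R]_5)
    (x : solpt E p) (d : 'I_3) (s : side) : R :=
  mass_flux_ec fS a u uext x d s - D x d s * delta_density u uext x d s.

Definition dissipation_min (R : realType) (E : finType) (p : nat)
    (fS : 'I_3 -> 'rV[R]_5 -> 'rV[R]_5 -> 'rV[R]_5)
    (a : E -> 'I_3 -> {ffun 'I_3 -> 'I_p.+2} -> 'rV[R]_3)
    (u : solpt E p -> 'rV[R]_5) (uext : solpt E p -> 'I_3 -> side -> 'rV[R]_5)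
    (x : solpt E p) (d : 'I_3) (s : side) : R :=
  `| mass_flux_ec fS a u uext x d s | / (2 * mean_density u uext x d s).

Definition dtau_denominator (R : realType) (E : finType) (p : nat)
    (J : solpt E p -> R) (xibar : 'I_p.+2 -> R)
    (D : solpt E p -> 'I_3 -> side -> R) (dt : R)
    (rhon rhok : solpt E p -> R) (x : solpt E p) : R :=
  2 / J x * (\sum_(d < 3) (D x d Plus + D x d Minus) / cv_width xibar (x.2 d))
  - 1 / dt * (rhon x / rhok x).

Definition dtau_bound (R : realType) (E : finType) (p : nat)
    (J : solpt E p -> R) (xibar : 'I_p.+2 -> R)
    (D : solpt E p -> 'I_3 -> side -> R) (dt : R)
    (rhon rhok : solpt E p -> R) : \bar R :=
  \big[Order.min/+oo%E]_(x : solpt E p)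
    (let q := dtau_denominator J xibar D dt rhon rhok x in
     if q <= 0 then +oo%E else (1 / q)%:E).

(* Main.v *)
Require Import Defs.
From HB Require Import structures.
From mathcomp Require Import all_boot all_order all_algebra.
From mathcomp Require Import all_classical all_reals all_analysis.
From mathcomp Require Import ring lra.
Import Order.TTheory GRing.Theory Num.Theory.
Import numFieldNormedType.Exports.
Local Open Scope ring_scope.

(* The lower bound on the dissipation gives |m| <= D (rho + rho_nbr), so that the
   neighbouring densities cancel with the right sign in the fluxes: their
   difference in direction d is at most 2 rho (D^+ + D^-).  Hence the bracket of
   the update is at least J rho (1 - dtau q), where q is the denominator in the
   bound on dtau. *)

(** The division-free form treats both kinds of solution points alike: a positive denominator [q] is
    cleared from [dtau < 1 / q], while at a point with [q <= 0], where the minimum receives [+oo],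
    the product is nonpositive anyway. *)
Lemma lt_dtau_bound (R : realType) (E : finType) (p : nat)
    (J : solpt E p -> R) (xibar : 'I_p.+2 -> R)
    (D : solpt E p -> 'I_3 -> side -> R) (dt dtau : R)
    (rhon rhok : solpt E p -> R) (x : solpt E p) :
  0 < dtau -> (dtau%:E < dtau_bound J xibar D dt rhon rhok)%E ->
  dtau * dtau_denominator J xibar D dt rhon rhok x < 1.
Proof.
move=> dtau_gt0 lt_dtau.
have := lt_le_trans lt_dtau (bigmin_le _ x _) => /=.
case: ifPn => [q_le0 _|]; last by rewrite -ltNge lte_fin => q_gt0; rewrite ltr_pdivlMr.
by apply: le_lt_trans ltr01; rewrite pmulr_rle0.
Qed.

Section FluxBound.
Variables (R : realType) (E : finType) (p : nat).
Variable fS : 'I_3 -> 'rV[R]_5 -> 'rV[R]_5 -> 'rV[R]_5.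
Variable a : E -> 'I_3 -> {ffun 'I_3 -> 'I_p.+2} -> 'rV[R]_3.
Variable D : solpt E p -> 'I_3 -> side -> R.
Variables (u : solpt E p -> 'rV[R]_5) (uext : solpt E p -> 'I_3 -> side -> 'rV[R]_5).
Variables (x : solpt E p) (d : 'I_3).
Hypothesis u_gt0 : 0 < density (u x).
Hypothesis nbr_gt0 : forall s, 0 < density (nbr_state u uext x d s).
Hypothesis D_ge : forall s, dissipation_min fS a u uext x d s <= D x d s.

Lemma norm_mass_flux_ec_le (s : side) :
  `|mass_flux_ec fS a u uext x d s| <=
    D x d s * (density (u x) + density (nbr_state u uext x d s)).
Proof.
(* The factor 2 in [dissipation_min] undoes the halving in the mean, so clearing this positive
   denominator in [D_ge] leaves the plain sum of densities. *)
have -> : density (u x) + density (nbr_state u uext x d s) =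
    2 * mean_density u uext x d s.
  by rewrite /mean_density mulrC divfK.
rewrite -ler_pdivrMr; first exact: D_ge.
by rewrite mulr_gt0// divr_gt0// addr_gt0.
Qed.

(** On the Plus side, [m <= D * (rho + rho_nbr)] is added to [- D * (rho_nbr - rho)]; on the Minus
    side, [- m <= D * (rho + rho_nbr)] is added to [D * (rho - rho_nbr)]. Either way [rho_nbr]
    cancels and [2 * rho * D] remains. *)
Lemma mass_flux_diff_le :
  mass_flux fS a D u uext x d Plus - mass_flux fS a D u uext x d Minus <=
    2 * density (u x) * (D x d Plus + D x d Minus).
Proof.
have := norm_mass_flux_ec_le Plus; rewrite ler_norml => /andP[_].
have := norm_mass_flux_ec_le Minus; rewrite ler_norml => /andP[+ _].
rewrite /mass_flux /delta_density; lra.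
Qed.

End FluxBound.

Theorem theorem1 (R : realType) (E : finType) (p : nat)
  (xi : 'I_p.+1 -> R) (xibar : 'I_p.+2 -> R)
  (X : E -> 'rV[R]_3 -> 'rV[R]_3)
  (a : E -> 'I_3 -> {ffun 'I_3 -> 'I_p.+2} -> 'rV[R]_3)
  (gam Rgas : R) (fS : 'I_3 -> 'rV[R]_5 -> 'rV[R]_5 -> 'rV[R]_5)
  (dt dtau : R)
  (uk : solpt E p -> 'rV[R]_5)
  (uext : solpt E p -> 'I_3 -> side -> 'rV[R]_5)
  (rhon rhok1 : solpt E p -> R)
  (D : solpt E p -> 'I_3 -> side -> R)
  (hp : (0 < p)%N)
  (hxi : lgl_nodes xi)
  (hxibar : lgl_flux_points xi xibar)
  (hwidth : forall i : 'I_p.+1, 0 < cv_width xibar i)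
  (hX : forall x : solpt E p, differentiable (X x.1) (ref_point xi x.2))
  (hJ : forall x : solpt E p, 0 < jac xi X x)
  (hgam : 1 < gam) (hRgas : 0 < Rgas)
  (hfS : entropy_conservative gam Rgas fS)
  (hdt : 0 < dt) (hdtau : 0 < dtau)
  (hrhok : forall x : solpt E p, 0 < density (uk x))
  (hrhok_nbr : forall (x : solpt E p) (d : 'I_3) (s : side),
     0 < density (nbr_state uk uext x d s))
  (hrhon : forall x : solpt E p, 0 < rhon x)
  (hupdate : forall x : solpt E p,
     jac xi X x * rhok1 x =
     dt / (dt + dtau) *
     (jac xi X x * density (uk x)
      + dtau / dt * jac xi X x * rhon x
      - dtau * \sum_(d < 3)
          (mass_flux fS a D uk uext x d Plus
           - mass_flux fS a D uk uext x d Minus) / cv_width xibar (x.2 d)))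
  (hD : forall (x : solpt E p) (d : 'I_3) (s : side),
     dissipation_min fS a uk uext x d s <= D x d s)
  (hbound : (dtau%:E <
     dtau_bound (jac xi X) xibar D dt rhon (fun x => density (uk x)))%E) :
  forall x : solpt E p, 0 < rhok1 x.
Proof.
move=> x.
have lt1 := @lt_dtau_bound _ _ _ _ _ _ _ _ _ _ x hdtau hbound.
have := hupdate x; move: lt1; rewrite /dtau_denominator.
set S := \sum_(d < 3) (D x d Plus + D x d Minus) / _.
set F := \sum_(d < 3) _ / _.
move=> lt1 upd.
have leFS : F <= 2 * density (uk x) * S.
  rewrite mulr_sumr; apply: ler_sum => d _.
  by rewrite mulrA ler_wpM2r ?invr_ge0 ?(ltW (hwidth _))// mass_flux_diff_le.
(* As [J] and [dt / (dt + dtau)] are positive, only the sign of the bracket matters. *)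
rewrite -(pmulr_rgt0 _ (hJ x)) upd mulr_gt0 ?(divr_gt0 hdt (addr_gt0 hdt hdtau))//.
have J_neq0 := lt0r_neq0 (hJ x); have r_neq0 := lt0r_neq0 (hrhok x).
have dt_neq0 := lt0r_neq0 hdt.
apply: (@lt_le_trans _ _ (jac xi X x * density (uk x) *
  (1 - dtau * (2 / jac xi X x * S - 1 / dt * (rhon x / density (uk x)))))).
  by rewrite !mulr_gt0 ?subr_gt0.
(* Expanding [J * rho * (1 - dtau * q)]: the factor [2 / J] loses its [J], and the subtracted
   density ratio in [q] restores exactly the physical-time term. The bracket then differs only by
   [F] in place of [2 * rho * S], which [leFS] compares. *)
have -> : jac xi X x * density (uk x) *
    (1 - dtau * (2 / jac xi X x * S - 1 / dt * (rhon x / density (uk x)))) =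
    jac xi X x * density (uk x) + dtau / dt * jac xi X x * rhon x
    - dtau * (2 * density (uk x) * S).
  by field; rewrite J_neq0 r_neq0 dt_neq0.
by rewrite lerB// ler_pM2l.
Qed.
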